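(* Let $\tau\in\{0,1\}^{\mathbb N}$ and let $(y^L)_{L\in\mathbb N}$ be an infinite family of alternating sequences in $\mathcal A^{\mathbb Z}$ satisfying $$\forall L\in\mathbb N,\ \exists i_L\in\mathbb Z:\quad y^L=S^{i_L}\varphi_{\tau_L}\bigl(y^{L+1}\bigr).$$ Then $y^0\in Y_\tau$.
   Context: Conventions: $\mathbb N=\{0,1,2,\dots\}$; $S$ is the shift, $(Sx)_n=x_{n+1}$; $\mathcal A=\{\mathtt A,\mathtt B,\mathtt C,\mathtt D\}$. Alternating sequences. $y\in\mathcal A^{\mathbb Z}$ is alternating if it contains neither two consecutive symbols in $\{\mathtt A,\mathtt C\}$ nor two consecutive symbols in $\{\mathtt B,\mathtt D\}$. Substitutions. $\varphi_0:\ \mathtt A\mapsto\mathtt A,\ \mathtt B\mapsto\mathtt D,\ \mathtt C\mapsto\mathtt{ABA},\ \mathtt D\mapsto\mathtt{DCD}$; $\varphi_1:\ \mathtt A\mapsto\mathtt B,\ \mathtt B\mapsto\mathtt C,\ \mathtt C\mapsto\mathtt{BAB},\ \mathtt D\mapsto\mathtt{CDC}$. They act on bi-infinite sequences by concatenation, $\varphi_t(y)=\cdots\varphi_t(y_{-1})\varphi_t(y_0)\varphi_t(y_1)\cdots$, indexed so that the block $\varphi_t(y_0)$ begins at index $0$. Smooth sequences. A mono-symbol block of $x\in\{1,3\}^{\mathbb Z}$ is a maximal run of equal consecutive symbols. If all mono-symbol blocks of $x$ are finite, $\Delta x$ is the bi-infinite sequence of lengths of the consecutive mono-symbol blocks of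 $x$, indexed so that $(\Delta x)_0$ is the length of the block containing position $0$. $x$ is smooth if $\Delta^k x$ is well-defined and in $\{1,3\}^{\mathbb Z}$ for all $k\ge0$. $X$ is the set of bi-infinite smooth sequences. Recoding. The letters encode the blocks $\mathtt A=1$, $\mathtt B=3$, $\mathtt C=111$, $\mathtt D=333$. For $x\in X$, $\mathrm{rec}(x)\in\mathcal A^{\mathbb Z}$ is the sequence of codes of the consecutive mono-symbol blocks of $x$, with $\mathrm{rec}(x)_0$ the code of the block containing $x_0$; $Y=\mathrm{rec}(X)$. The derivative on $Y$ is defined by $\Delta(\mathrm{rec}(x)):=\mathrm{rec}(\Delta x)$. Each letter of $y=\mathrm{rec}(x)$ corresponds to one letter of $\Delta x$. The factor of $y$ corresponding to a mono-symbol block of $\Delta x$ is called an elementary block of $y$: the block $1$ gives $\mathtt A$ or $\mathtt B$; $3$ gives $\mathtt C$ or $\mathtt D$; $111$ gives $\mathtt{ABA}$ or $\mathtt{BAB}$; $333$ gives $\mathtt{CDC}$ or $\mathtt{DCD}$. Types. $y=\mathrm{rec}(x)\in Y$ (and $x$) has type $0$ if $y$ contains an elementary block in $\{\mathtt{ABA},\mathtt{DCD}\}$, and type $1$ if it contains an elementary block in $\{\mathtt{BAB},\mathtt{CDC}\}$; every $y\in Y$ has exactly one type. $\mathrm{Types}(y)=(\mathrm{type}(\Delta^n y))_{n\in\mathbb N}$, and $Y_\tau=\{y\in Y:\mathrm{Types}(y)=\tau\}$. *)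

(* Defs.v *)
From HB Require Import structures.
From mathcomp Require Import all_boot all_order all_algebra.
From mathcomp Require Import boolp classical_sets.

Set Implicit Arguments.
Unset Strict Implicit.
Unset Printing Implicit Defensive.

Import Order.TTheory GRing.Theory Num.Theory.
Local Open Scope ring_scope.

(* The alphabet {A, B, C, D}. *)
Inductive letter := LA | LB | LC | LD.

Definition letter_code (a : letter) : bool * bool :=
  match a with
  | LA => (false, false) | LB => (false, true)
  | LC => (true, false) | LD => (true, true)
  end.

Definition letter_decode (u : bool * bool) : letter :=
  match u with
  | (false, false) => LA | (false, true) => LB
  | (true, false) => LC | (true, true) => LD
  end.

Lemma letter_codeK : cancel letter_code letter_decode.
Proof. by case. Qed.

HB.instance Definition _ := Equality.copy letter (can_type letter_codeK).

Definition biseq (T : Type) := int -> T.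

(* The i-th power of the shift (S x)_n = x_(n+1), for i in Z. *)
Definition shift (T : Type) (i : int) (x : biseq T) : biseq T :=
  fun n => x (n + i).

Definition alternating (y : biseq letter) : Prop :=
  forall n : int,
    ~ (y n \in [:: LA; LC] /\ y (n + 1) \in [:: LA; LC]) /\
    ~ (y n \in [:: LB; LD] /\ y (n + 1) \in [:: LB; LD]).

(* The substitutions phi_0 (t = false) and phi_1 (t = true). *)
Definition phi (t : bool) (a : letter) : seq letter :=
  if t then
    match a with
    | LA => [:: LB] | LB => [:: LC]
    | LC => [:: LB; LA; LB] | LD => [:: LC; LD; LC]
    end
  else
    match a with
    | LA => [:: LA] | LB => [:: LD]
    | LC => [:: LA; LB; LA] | LD => [:: LD; LC; LD]
    end.

(* Bi-infinite concatenation ... f(y_(-1)) f(y_0) f(y_1) ..., with f(y_0)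
   beginning at index 0, for f with nonempty values: then n + 1 blocks on
   either side of the origin are enough to reach index n, resp. - n - 1.  The
   left half is read from right to left, Negz n being - n - 1; the default
   letter of nth is never used. *)
Definition substitute (f : letter -> seq letter) (y : biseq letter)
    : biseq letter :=
  fun i =>
    match i with
    | Posz n => nth LA (flatten [seq f (y (Posz k)) | k <- iota 0 n.+1]) n
    | Negz n => nth LA (flatten [seq rev (f (y (Negz k))) | k <- iota 0 n.+1]) n
    end.

(* All mono-symbol blocks of x are finite. *)
Definition finite_blocks (x : biseq nat) : Prop :=
  forall i : int,
    (exists2 j, j < i & x j <> x i) /\ (exists2 j, i < j & x j <> x i).

(* p k is the first position of the k-th mono-symbol block of x, block 0 being
   the one that contains position 0. *)
Definition is_block_start (x : biseq nat) (p : int -> int) : Prop :=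
  p 0 <= 0 < p 1 /\
  forall k : int,
    [/\ p k < p (k + 1),
        (forall i, p k <= i < p (k + 1) -> x i = x (p k))
      & x (p (k + 1)) <> x (p k)].

(* Such a p is unique, and it exists exactly when finite_blocks x holds; the
   default value id is irrelevant for smooth sequences. *)
Definition block_start (x : biseq nat) : int -> int :=
  @xget (int -> int) id [set p | is_block_start x p].

Definition Delta (x : biseq nat) : biseq nat :=
  fun k => `|block_start x (k + 1) - block_start x k|%N.

Definition smooth (x : biseq nat) : Prop :=
  forall k : nat,
    finite_blocks (iter k Delta x) /\
    forall n : int, iter k Delta x n \in [:: 1%N; 3%N].

(* The code of the block made of l copies of s, for s and l in {1, 3}. *)
Definition code (s l : nat) : letter :=
  if s == 1%N then (if l == 1%N then LA else LC)
  else (if l == 1%N then LB else LD).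

Definition rec (x : biseq nat) : biseq letter :=
  fun k => code (x (block_start x k)) (Delta x k).

Definition Y (y : biseq letter) : Prop := exists2 x, smooth x & rec x = y.

(* rec is not injective on smooth sequences, but Delta x only depends on
   rec x, so that the choice of x does not matter: see Delta_letter_rec. *)
Definition Delta_letter (y : biseq letter) : biseq letter :=
  rec (Delta (@xget (int -> nat) (fun=> 1%N) [set x | smooth x /\ rec x = y])).

(* w is the factor of y = rec x at the positions of some mono-symbol block of
   Delta x. *)
Definition elementary_block (y : biseq letter) (w : seq letter) : Prop :=
  exists2 x, smooth x /\ rec x = y &
    exists k : int,
      w = [seq y (block_start (Delta x) k + Posz j)
             | j <- iota 0 (Delta (Delta x) k)].

(* Type 0 is t = false and type 1 is t = true. *)
Definition has_type (y : biseq letter) (t : bool) : Prop :=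
  exists2 w, elementary_block y w &
    w \in (if t then [:: [:: LB; LA; LB]; [:: LC; LD; LC]]
           else [:: [:: LA; LB; LA]; [:: LD; LC; LD]]).

(* Types y = tau: for every n, tau n is the one and only type of Delta^n y. *)
Definition is_Types (y : biseq letter) (tau : nat -> bool) : Prop :=
  forall (n : nat) (t : bool),
    has_type (iter n Delta_letter y) t <-> t = tau n.

Definition Y_ (tau : nat -> bool) (y : biseq letter) : Prop :=
  Y y /\ is_Types y tau.

Lemma smooth_Delta x : smooth x -> smooth (Delta x).
Proof. by move=> sx k; rewrite -iterSr; apply: sx. Qed.

Lemma Delta_rec_inj x x' :
  smooth x -> smooth x' -> rec x = rec x' -> Delta x = Delta x'.
Proof.
move=> sx sx' e; apply/funext => k.
have [_ /(_ k) /= lx] := sx 1%N; have [_ /(_ k) /= lx'] := sx' 1%N.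
move/(congr1 (fun y => y k)): e; rewrite /rec /code; move: lx lx'; rewrite !inE.
by do 2 case: (_ (block_start _ _) == 1%N);
  move=> /orP[] /eqP-> /orP[] /eqP->.
Qed.

Lemma Delta_letter_rec x : smooth x -> Delta_letter (rec x) = rec (Delta x).
Proof.
move=> sx; rewrite /Delta_letter; congr rec.
case: xgetP => [x' _ [sx' e]|/(_ x)]; first exact: Delta_rec_inj.
by case.
Qed.

(* Main.v *)
(* Replacing each letter of [y L] by the length of the block it encodes turns
   [phi t a] into the block encoded by [a], for both values of [t].  Hence, if
   x decodes [y 0], then Delta^n x decodes [y n] up to a shift: all derivatives
   exist, and the elementary blocks of Delta^n (y 0) are the words
   [phi (tau n) (y n.+1 k)].  They never belong to the other type, and some of
   them have length 3, because [phi t] maps B and D to words containing C or D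
   and an alternating sequence contains B or D. *)
Require Import Defs.
From mathcomp Require Import all_boot all_order all_algebra.
From mathcomp Require Import boolp classical_sets zify.

Set Implicit Arguments.
Unset Strict Implicit.
Unset Printing Implicit Defensive.

Import Order.TTheory GRing.Theory Num.Theory.
Local Open Scope ring_scope.

(** * Increasing integer sequences and uniqueness of the block decomposition *)

Lemma int_ind_iff (P : int -> Prop) :
  P 0 -> (forall k, P k <-> P (k + 1)) -> forall k, P k.
Proof.
move=> P0 PS k; elim/int_rect: k => [//|n IHn|n IHn].
  by rewrite -addn1 PoszD; apply: (PS _).1.
by apply: (PS _).2; rewrite (_ : _ + 1 = - Posz n) //; lia.
Qed.

(** Induction in both directions from [p 0]: moving [i] by one moves the index [k] by at most
    one. *)
Lemma int_steps_cover (p : int -> int) :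
  (forall k, p k < p (k + 1)) -> forall i, exists k, p k <= i < p (k + 1).
Proof.
move=> p_lt i; rewrite -(subrK (p 0) i).
elim/int_ind_iff: (i - p 0) => [|j].
  by exists 0; have := p_lt 0; rewrite !add0r; lia.
split=> -[k k_j].
  have [lt_j|ge_j] := ltP (j + 1 + p 0) (p (k + 1)); first by exists k; lia.
  by exists (k + 1); have := p_lt (k + 1); lia.
have [le_j|gt_j] := leP (p k) (j + p 0); first by exists k; lia.
by exists (k - 1); have := p_lt (k - 1); rewrite subrK; lia.
Qed.

(** [x] changes between [q l - 1] and [q l], which cannot happen strictly inside a block of [p]. *)
Lemma block_start_align x p q k l :
    is_block_start x p -> is_block_start x q ->
  p k <= q l < p (k + 1) -> q l = p k.
Proof.
move=> [_ /(_ k) [_ px _]] [_ /(_ (l - 1))]; rewrite subrK => -[q_lt qx qx'] kl.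
have [//|ne] := eqVneq (q l) (p k); case: qx'.
rewrite -(qx (q l - 1)); last by lia.
by rewrite (px (q l)) ?(px (q l - 1)) //; lia.
Qed.

Lemma is_block_start_uniq x p q :
  is_block_start x p -> is_block_start x q -> p = q.
Proof.
move=> xp xq; apply/funext; apply: int_ind_iff => [|k].
  (* Both blocks of index 0 contain position 0, so the larger of [p 0] and [q 0] lies in block 0 of
     the other sequence. *)
  have [[p0 _] [q0 _]] := (xp, xq).
  have [le|lt] := leP (p 0) (q 0).
    by rewrite (block_start_align (k := 0) (l := 0) xp xq) // add0r; lia.
  by rewrite (block_start_align (k := 0) (l := 0) xq xp) // add0r; lia.
have [[_ /(_ k) [p_lt _ _]] [_ /(_ k) [q_lt _ _]]] := (xp, xq).
have pq := block_start_align (k := k) xp xq.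
have qp := block_start_align (k := k) xq xp.
have := (pq k, pq (k + 1), qp k, qp (k + 1)) => {pq qp} -[[[]]]; lia.
Qed.

Lemma block_startE x p : is_block_start x p -> block_start x = p.
Proof.
move=> xp; rewrite /block_start; case: xgetP => [q _ xq|/(_ p)//].
exact: is_block_start_uniq xq xp.
Qed.

Lemma is_block_start_finite x p : is_block_start x p -> finite_blocks x.
Proof.
move=> [_ xp] i.
have [k ki] := @int_steps_cover p (fun k => let: And3 l _ _ := xp k in l) i.
have [p_lt px px'] := xp k; have [] := xp (k - 1); rewrite subrK => p_lt1 _ ne.
rewrite px //; split; last by exists (p (k + 1)) => //; lia.
by exists (p (k - 1)) => [|/esym//]; lia.
Qed.

(** * Parsing a bi-infinite sequence into words *)

Definition factor (T : Type) (z : biseq T) (a : int) (n : nat) : seq T :=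
  [seq z (a + Posz j) | j <- iota 0 n].

(* z is the concatenation of the words f (y k); p 0 is arbitrary, so that the
   relation is stable under shifts of y and of z. *)
Definition parses (S T : Type) (f : S -> seq T) (y : biseq S) (z : biseq T)
    (p : int -> int) : Prop :=
  forall k, p (k + 1) = p k + Posz (size (f (y k))) /\
            factor z (p k) (size (f (y k))) = f (y k).

Lemma parses_map (S T U : Type) (f : S -> seq T) (h : T -> U) y z p :
  parses f y z p -> parses (fun a => map h (f a)) y (h \o z) p.
Proof.
move=> fz k; have [pk zk] := fz k; rewrite size_map; split=> //.
by rewrite -[in RHS]zk -map_comp.
Qed.

Lemma parses_shift (S T : Type) (f : S -> seq T) i y z p :
  parses f y z p -> parses f y (shift i z) (fun k => p k - i).
Proof.
move=> fz k; have [pk zk] := fz k; split; first by lia.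
rewrite -[in RHS]zk; apply: eq_map => j /=.
by rewrite /shift addrAC subrK.
Qed.

Lemma parses_reindex (S T : Type) (f : S -> seq T) m y z p :
  parses f y z p -> parses f (shift m y) z (fun k => p (k + m)).
Proof. by move=> fz k; rewrite addrAC; apply: fz. Qed.

(** Index 0 is moved to the word covering position 0, as [is_block_start] demands; such a word
    exists because nonempty words make [p] strictly increasing. *)
Lemma parses_normalize (S T : Type) (f : S -> seq T) y z p :
    (forall a, (0 < size (f a))%N) -> parses f y z p ->
  exists m q, parses f (shift m y) z q /\ q 0 <= 0 < q 1.
Proof.
move=> f_gt0 fz; have [|m m0] := @int_steps_cover p _ 0.
  by move=> k; have [-> _] := fz k; have := f_gt0 (y k); lia.
exists m, (fun k => p (k + m)); split; first exact: parses_reindex.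
by rewrite add0r addrC.
Qed.

(** * Substitution yields a parsed sequence *)

Section Substitute.
Variables (f : letter -> seq letter) (y : biseq letter).
Hypothesis f_gt0 : forall a, (0 < size (f a))%N.

Lemma leq_size_flatten (g : nat -> seq letter) n :
    (forall k, (0 < size (g k))%N) ->
  (n <= size (flatten [seq g k | k <- iota 0 n]))%N.
Proof.
move=> g_gt0; elim: n => // n IHn.
rewrite -addn1 iotaD map_cat flatten_cat size_cat /= cats0 add0n.
by rewrite leq_add.
Qed.

(** Justifies the truncation in [substitute]: nonempty words give [k <= N], so the first [N.+1]
    words include word [k], where index [N] falls. *)
Lemma nth_flatten_prefix (g : nat -> seq letter) k j
    (N := (size (flatten [seq g i | i <- iota 0 k]) + j)%N) :
    (forall i, (0 < size (g i))%N) -> (j < size (g k))%N ->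
  nth LA (flatten [seq g i | i <- iota 0 N.+1]) N = nth LA (g k) j.
Proof.
move=> g_gt0 ltj; have leN := leq_size_flatten k g_gt0.
have -> : N.+1 = (k + (N - k).+1)%N by rewrite /N; lia.
rewrite iotaD map_cat flatten_cat nth_cat /= add0n.
by rewrite /N ltnNge leq_addr /= addKn nth_cat ltj.
Qed.

(** For [Negz n], that is - n - 1, the count includes the word of [Negz n] itself, which also lies
    left of the origin; hence [n.+1] words. *)
Definition substitute_start (k : int) : int :=
  match k with
  | Posz n => Posz (size (flatten [seq f (y (Posz i)) | i <- iota 0 n]))
  | Negz n =>
      - Posz (size (flatten [seq rev (f (y (Negz i))) | i <- iota 0 n.+1]))
  end.

Lemma parses_substitute : parses f y (substitute f y) substitute_start.
Proof.
move=> [] n.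
  split; first by rewrite -PoszD /= addn1 -addn1 iotaD map_cat flatten_cat
    size_cat /= cats0 PoszD.
  apply: (@eq_from_nth _ LA); first by rewrite size_map size_iota.
  move=> j; rewrite size_map size_iota => ltj.
  rewrite (nth_map 0%N) ?size_iota // nth_iota // add0n.
  exact: (@nth_flatten_prefix (fun i => f (y (Posz i)))).
have startE : substitute_start (Negz n) =
    - (Posz (size (flatten [seq rev (f (y (Negz i))) | i <- iota 0 n]))
       + Posz (size (f (y (Negz n))))).
  rewrite /substitute_start -addn1 iotaD map_cat flatten_cat size_cat /=.
  by rewrite cats0 size_rev PoszD add0n.
split.
  rewrite startE opprD subrK; case: n {startE} => [|n] //.
  by rewrite (_ : Negz n.+1 + 1 = Negz n) //; lia.
apply: (@eq_from_nth _ LA); first by rewrite size_map size_iota.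
move=> j; rewrite size_map size_iota => ltj.
rewrite (nth_map 0%N) ?size_iota // nth_iota // add0n startE.
(* Read from the right, letter [j] of this word has index [s - j.+1], after the [M] letters of the
   words nearer the origin. *)
set s := size (f _) in ltj *; set M := size (flatten _).
have -> : - (Posz M + Posz s) + Posz j = Negz (M + (s - j.+1)) by lia.
rewrite /= (@nth_flatten_prefix (fun i => rev (f (y (Negz i))))); last 2 first.
- by move=> i; rewrite size_rev.
- by rewrite size_rev -/s; lia.
by rewrite nth_rev -/s; [congr nth|]; lia.
Qed.

End Substitute.

(** * Decoding letters into mono-symbol blocks *)

Definition sym (a : letter) : nat := if a is (LA | LC) then 1 else 3.
Definition len (a : letter) : nat := if a is (LA | LB) then 1 else 3.
Definition decode (a : letter) : seq nat := nseq (len a) (sym a).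

Lemma code_sym_len a : code (sym a) (len a) = a.
Proof. by case: a. Qed.

Lemma sym13 a : sym a \in [:: 1%N; 3%N].
Proof. by case: a. Qed.

Lemma decode_gt0 a : (0 < size (decode a))%N.
Proof. by case: a. Qed.

Lemma phi_gt0 t a : (0 < size (phi t a))%N.
Proof. by case: t; case: a. Qed.

Lemma map_len_phi t a : map len (phi t a) = decode a.
Proof. by case: t; case: a. Qed.

(** This is what makes the decoded words maximal runs. *)
Lemma alternating_sym y k : alternating y -> sym (y (k + 1)) <> sym (y k).
Proof.
move=> /(_ k) [nAC nBD] e; move: nAC nBD e.
case: (y k); case: (y (k + 1)) => // nAC nBD _;
  by [case: nAC | case: nBD].
Qed.

Lemma alternating_shift m y : alternating y -> alternating (shift m y).
Proof. by move=> y_alt k; rewrite /shift addrAC; apply: y_alt. Qed.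

Lemma parses_decode_sym y x p k i :
  parses decode y x p -> p k <= i < p (k + 1) -> x i = sym (y k).
Proof.
move=> /(_ k) []; rewrite size_nseq => -> xk ki.
have [j -> ltj] : exists2 j, i = p k + Posz j & (j < len (y k))%N.
  by exists `|i - p k|%N; lia.
move/(congr1 (nth 0%N ^~ j)): xk.
by rewrite (nth_map 0%N) ?size_iota // nth_iota // nth_nseq ltj.
Qed.

(** Fixing the word boundaries to be the block starts makes [rec x] equal to [y] itself, not just to
    a shift of it. The second conjunct excludes the default value of [block_start]. *)
Definition decodes (y : biseq letter) (x : biseq nat) : Prop :=
  parses decode y x (block_start x) /\ is_block_start x (block_start x).

Lemma parses_is_block_start y x p :
    alternating y -> parses decode y x p -> p 0 <= 0 < p 1 ->
  is_block_start x p.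
Proof.
move=> y_alt yx p0.
have p_lt k : p k < p (k + 1).
  by have [-> _] := yx k; have := decode_gt0 (y k); lia.
have xp k : x (p k) = sym (y k).
  by apply: (parses_decode_sym yx); rewrite lexx p_lt.
split=> // k; split=> //; last by rewrite !xp; apply: alternating_sym.
by move=> i ki; rewrite xp; apply: parses_decode_sym ki.
Qed.

Lemma parses_decodes y x p :
  alternating y -> parses decode y x p -> p 0 <= 0 < p 1 -> decodes y x.
Proof.
move=> y_alt yx p0; have xp := parses_is_block_start y_alt yx p0.
by rewrite /decodes (block_startE xp).
Qed.

Lemma decodes_Delta y x : decodes y x -> Delta x = len \o y.
Proof.
move=> [yx _]; apply/funext => k; rewrite /Delta /=.
by have [-> _] := yx k; rewrite addrC addKr size_nseq.
Qed.

Lemma decodes_rec y x : decodes y x -> rec x = y.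
Proof.
move=> yx; apply/funext => k; rewrite /rec (decodes_Delta yx) /=.
have [yp [_ /(_ k) [p_lt _ _]]] := yx.
by rewrite (@parses_decode_sym y x _ k _ yp) ?lexx // code_sym_len.
Qed.

Lemma decodes_finite_blocks y x : decodes y x -> finite_blocks x.
Proof. by case=> _; apply: is_block_start_finite. Qed.

Lemma decodes13 y x n : decodes y x -> x n \in [:: 1%N; 3%N].
Proof.
move=> [yx [_ xb]].
have [k kn] := @int_steps_cover _ (fun k => let: And3 l _ _ := xb k in l) n.
by rewrite (parses_decode_sym yx kn) sym13.
Qed.

Lemma decodes_exists y : alternating y -> exists x, decodes y x.
Proof.
(* [substitute] only produces letters, so [LA] and [LB] stand for the symbols 1 and 3 until [sym] is
   applied. *)
move=> y_alt; pose f a := nseq (len a) (if a is (LA | LC) then LA else LB).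
have f_gt0 a : (0 < size (f a))%N by case: a.
exists (sym \o substitute f y).
have := parses_map sym (parses_substitute y f_gt0).
have -> : (fun a => map sym (f a)) = decode by apply/funext; case.
move=> yx; apply: (parses_decodes y_alt yx).
have [-> _] := yx 0; have := decode_gt0 (y 0).
by rewrite (_ : substitute_start f y 0 = 0) // add0r.
Qed.

(** One derivation step. Applying [len] to the parse of [y] by [phi t] gives a parse of [Delta x] by
    [decode] with the same boundaries, so the blocks of [Delta x] cut [y] into the words of [phi t].
    The shift [m] restores the indexing at 0. *)
Lemma decodes_factor t y z x :
    alternating z -> decodes y x ->
    (exists i, y = shift i (substitute (phi t) z)) ->
  exists m, decodes (shift m z) (Delta x) /\
    forall k, factor y (block_start (Delta x) k) (Delta (Delta x) k)
              = phi t (shift m z k).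
Proof.
move=> z_alt yx [i y_phi].
have [m [q [yq q0]]] : exists m q,
    parses (phi t) (shift m z) y q /\ q 0 <= 0 < q 1.
  apply: (parses_normalize (@phi_gt0 t)); rewrite y_phi.
  exact: parses_shift (parses_substitute z (@phi_gt0 t)).
have zq : parses decode (shift m z) (Delta x) q.
  rewrite (decodes_Delta yx).
  have -> : decode = fun a => map len (phi t a).
    by apply/funext => a; rewrite map_len_phi.
  exact: parses_map.
have z_alt' := alternating_shift m z_alt.
have dz := parses_decodes z_alt' zq q0.
exists m; split=> // k; have [_ <-] := yq k.
rewrite (block_startE (parses_is_block_start z_alt' zq q0)).
congr factor; rewrite (decodes_Delta dz) /= -(size_map len) map_len_phi.
by rewrite size_nseq.
Qed.

(** * Elementary blocks and types *)

Definition type_words (t : bool) : seq (seq letter) :=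
  if t then [:: [:: LB; LA; LB]; [:: LC; LD; LC]]
  else [:: [:: LA; LB; LA]; [:: LD; LC; LD]].

Lemma phi_type_words t t' a :
  (phi t a \in type_words t') = (t == t') && (a \in [:: LC; LD]).
Proof. by case: t; case: t'; case: a. Qed.

Lemma long_letter t y z :
    alternating z -> (exists i, y = shift i (substitute (phi t) z)) ->
  exists k, y k \in [:: LC; LD].
Proof.
move=> z_alt [i ->].
have [k zk] : exists k, z k \in [:: LB; LD].
  have [nAC _] := z_alt 0; have [|z0] := boolP (z 0 \in [:: LB; LD]).
    by exists 0.
  exists (0 + 1); move: nAC z0; case: (z 0); case: (z (0 + 1)) => // nAC _;
    by case: nAC.
have /hasP[a] : has [in [:: LC; LD]] (phi t (z k)).
  by move: zk; case: (t); case: (z k).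
have [_ <-] := parses_substitute z (@phi_gt0 t) k.
by case/mapP => j _ -> zj; eexists (_ - i); rewrite /shift subrK; apply: zj.
Qed.

Lemma shift_shift (T : Type) i j (x : biseq T) :
  shift i (shift j x) = shift (i + j) x.
Proof. by apply/funext => k; rewrite /shift addrA. Qed.

Lemma has_type_phi t t' y z x :
    smooth x -> decodes y x -> alternating z ->
    (exists i, y = shift i (substitute (phi t) z)) ->
    (exists k, z k \in [:: LC; LD]) ->
  has_type y t' <-> t' = t.
Proof.
move=> sx yx z_alt y_phi [k zk].
have [m [_ yz]] := decodes_factor z_alt yx y_phi; split=> [|->].
  case=> w [x' [sx' x'y] [l ->]].
  (* The preimage [x'] in [has_type] is arbitrary, but its derivative, hence its cutting of [y], is
     that of [x]. *)
  rewrite (Delta_rec_inj sx' sx) ?(decodes_rec yx) // -/(factor _ _ _) yz.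
  by rewrite -/(type_words t') phi_type_words => /andP[/eqP].
exists (phi t (z k)).
  exists x; first by rewrite (decodes_rec yx).
  by exists (k - m); rewrite -/(factor _ _ _) yz /shift subrK.
by rewrite -/(type_words t) phi_type_words eqxx.
Qed.

Theorem proposition2p13 (tau : nat -> bool) (y : nat -> biseq letter)
    (y_alt : forall L : nat, alternating (y L))
    (y_phi : forall L : nat, exists i : int,
       y L = shift i (substitute (phi (tau L)) (y L.+1))) :
  Y_ tau (y 0%N).
Proof.
(* [Delta^n x] decodes only a shift of [y n], so the relation between levels is needed for all
   shifts. *)
have y_phi_shift n m : exists i,
    shift m (y n) = shift i (substitute (phi (tau n)) (y n.+1)).
  by have [i ->] := y_phi n; exists (m + i); rewrite shift_shift.
have [x yx] := decodes_exists (y_alt 0%N).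
have yxn n : exists m, decodes (shift m (y n)) (iter n Delta x).
  elim: n => [|n [m yxn]].
    exists 0; rewrite (_ : shift 0 _ = y 0%N) //.
    by apply/funext => k; rewrite /shift addr0.
  have [m' [? _]] := decodes_factor (y_alt n.+1) yxn (y_phi_shift n m).
  by exists m'.
have sx : smooth x.
  move=> n; have [m yn] := yxn n; split; first exact: decodes_finite_blocks yn.
  by move=> k; apply: decodes13 yn.
have sxn n : smooth (iter n Delta x).
  by elim: n => //= n; apply: smooth_Delta.
split=> [|n t]; first by exists x; rewrite ?(decodes_rec yx).
have [m yn] := yxn n.
have -> : iter n Delta_letter (y 0%N) = shift m (y n).
  rewrite -(decodes_rec yn) -(decodes_rec yx).
  elim: n {m yn} => //= n ->; exact: Delta_letter_rec.
(* An elementary block of length 3 at level [n] needs a C or D in [y n.+1], which is obtained from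
   [y n.+2]. *)
have /(long_letter (y_alt n.+2)) := y_phi n.+1.
exact: has_type_phi (sxn n) yn (y_alt n.+1) (y_phi_shift n m).
Qed.
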